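(* Let $\Bbbk$ be a field. Then $(H^\circ,\mu,\delta^\circ,\eta,\varepsilon_\delta)$ is a bialgebra.
   Context: A hypergraph $(E,V)$ is a map of sets $h:E\to P(V)$, with $P(V)$ the power set of $V$; elements of $E$ are edges, elements of $V$ are vertices, and an edge $e$ is identified with its vertex set $h(e)\subseteq V$. Distinct edges may have the same vertex set. $H^\circ$ is the $\Bbbk$-vector space with basis the isomorphism classes of hypergraphs with $E,V$ finite and with no edge having empty vertex set. Product $\mu$: disjoint union, $(E,V,h)\cdot(E',V',h')=(E\sqcup E',V\sqcup V',h\sqcup h')$, with unit $\eta:\Bbbk\to H^\circ$, $1\mapsto(\emptyset,\emptyset)$. Coproduct: $\delta^\circ(E,V)=\sum_{F\subseteq E}(F,V)\otimes(F^c,V/F)$, where $F^c=E\setminus F$, $(F,V)$ is the restriction of $h$ to $F$, $V/F$ is the quotient of $V$ by the equivalence relation generated by $u\sim u'$ if $u,u'$ lie on a common edge of $F$ (vertices on no edge of $F$ form singleton classes), and $(F^c,V/F)$ is the hypergraph given by $F^c\subseteq E\to P(V)\to P(V/F)$, the last map being direct image under the quotient map. Counit: $\varepsilon_\delta(E,V)=1$ if $E=\emptyset$ and $0$ otherwise. *)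

(* Defs.v *)
From HB Require Import structures.
From mathcomp Require Import all_boot all_algebra.
From mathcomp Require Import finmap generic_quotient ring_quotient sesquilinear.
From mathcomp Require Import boolp.
From mathcomp Require Import monalg.

Set Implicit Arguments.
Unset Strict Implicit.
Unset Printing Implicit Defensive.

Import GRing.Theory.
Local Open Scope ring_scope.
Local Open Scope quotient_scope.

Reserved Notation "U ⊗ V" (at level 40, left associativity).
Reserved Notation "u *t v" (at level 40, left associativity).

HB.lock Definition lin_ext (K : fieldType) (I : choiceType) (W : lmodType K)
    (f : I -> W) (x : {malg K[I]}) : W :=
  \sum_(i <- msupp x) x@_i *: f i.

Section LinearExtension.
Variables (K : fieldType) (I : choiceType) (W : lmodType K).
Implicit Types (f : I -> W) (x : {malg K[I]}).

Lemma lin_extEw f x (D : {fset I}) : (msupp x `<=` D)%fset ->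
  lin_ext f x = \sum_(i <- D) x@_i *: f i.
Proof.
move=> sub; rewrite lin_ext.unlock (big_fset_incl _ sub) //= => i _.
by move/mcoeff_outdom => ->; rewrite scale0r.
Qed.

Lemma lin_ext_is_linear f : linear (lin_ext f).
Proof.
move=> a x y.
pose D := (msupp x `|` msupp y `|` msupp (a *: x + y))%fset.
have sx : (msupp x `<=` D)%fset by rewrite /D -fsetUA fsubsetUl.
have sy : (msupp y `<=` D)%fset by rewrite /D fsetUAC fsubsetUr.
have sxy : (msupp (a *: x + y) `<=` D)%fset by rewrite fsubsetUr.
rewrite (lin_extEw _ sx) (lin_extEw _ sy) (lin_extEw _ sxy).
rewrite scaler_sumr -big_split /=; apply: eq_bigr => i _.
by rewrite mcoeffD mcoeffZ scalerDl scalerA.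
Qed.

HB.instance Definition _ f :=
  GRing.isLinear.Build K {malg K[I]} W *:%R (lin_ext f) (lin_ext_is_linear f).

Lemma lin_extU f i : lin_ext f << i >> = f i.
Proof.
have s : (msupp << (1 : K) *g i >> `<=` [fset i])%fset by exact: msuppU_le.
by rewrite (lin_extEw _ s) big_seq_fset1 mcoeffUU scale1r.
Qed.

Lemma eq_lin_ext f g x : f =1 g -> lin_ext f x = lin_ext g x.
Proof. by move=> e; rewrite lin_ext.unlock; apply: eq_bigr => i _; rewrite e. Qed.

Lemma lin_ext_fun a f g x :
  lin_ext (fun i => a *: f i + g i) x = a *: lin_ext f x + lin_ext g x.
Proof.
rewrite lin_ext.unlock scaler_sumr -big_split /=; apply: eq_bigr => i _.
by rewrite scalerDr !scalerA mulrC.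
Qed.

Lemma lin_ext_uniq (g : {linear {malg K[I]} -> W}) x :
  g x = lin_ext (fun i => g << i >>) x.
Proof.
rewrite lin_ext.unlock {1}[x]monalgE linear_sum; apply: eq_bigr => i _.
rewrite -linearZ; congr (g _).
by apply/malgP => j; rewrite mcoeffZ !mcoeffU mulrnAr mulr1.
Qed.

End LinearExtension.

(* Tensor product of two vector spaces: the quotient of the free vector
   space on the set U * V by the subspace spanned by the bilinearity
   relations.  Its universal property is tliftE, tlift_is_linear and
   tens_ext. *)

Section Tensor.
Variables (K : fieldType) (U V : lmodType K).

Inductive tens_null : {malg K[(U * V)%type]} -> Prop :=
| TensNull0 : tens_null 0
| TensNullZD a x y : tens_null x -> tens_null y -> tens_null (a *: x + y)
| TensNullL a u u' v :
    tens_null (<< (a *: u + u', v) >> - (a *: << (u, v) >> + << (u', v) >>))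
| TensNullR a u v v' :
    tens_null (<< (u, a *: v + v') >> - (a *: << (u, v) >> + << (u, v') >>)).

Definition tens_nullb : {pred {malg K[(U * V)%type]}} :=
  fun x => `[< tens_null x >].

Lemma tens_nullP x : reflect (tens_null x) (x \in tens_nullb).
Proof. exact: asboolP. Qed.

Lemma tens_null_zmod_closed : zmod_closed tens_nullb.
Proof.
split=> [|x y /tens_nullP hx /tens_nullP hy]; apply/tens_nullP.
  exact: TensNull0.
by rewrite addrC -scaleN1r; apply: TensNullZD.
Qed.

HB.instance Definition _ :=
  GRing.isZmodClosed.Build {malg K[(U * V)%type]} tens_nullb
    tens_null_zmod_closed.

Definition tensor : Type := Quotient.quot tens_nullb.
HB.instance Definition _ := GRing.Zmodule.on tensor.

Definition tpi : {malg K[(U * V)%type]} -> tensor :=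
  \pi_(Quotient.quot tens_nullb).
Definition trepr (t : tensor) : {malg K[(U * V)%type]} :=
  repr (t : Quotient.quot tens_nullb).

Lemma treprK : cancel trepr tpi. Proof. exact: reprK. Qed.

Lemma tpi_eq x y : tens_null (x - y) -> tpi x = tpi y.
Proof. by move/tens_nullP; rewrite Quotient.idealrBE => /eqP. Qed.

Lemma tpi_null x y : tpi x = tpi y -> tens_null (x - y).
Proof. by move=> e; apply/tens_nullP; rewrite Quotient.idealrBE; apply/eqP. Qed.

Lemma tpiD x y : tpi (x + y) = tpi x + tpi y.
Proof. exact: (raddfD \pi_(Quotient.quot tens_nullb)). Qed.

Definition tscale (a : K) (t : tensor) : tensor := tpi (a *: trepr t).

Lemma tpiZ a x : tpi (a *: x) = tscale a (tpi x).
Proof.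
apply: tpi_eq; rewrite -scalerBr -[_ *: _]addr0; apply: TensNullZD TensNull0.
by apply: tpi_null; rewrite treprK.
Qed.

Lemma tscaleA a b t : tscale a (tscale b t) = tscale (a * b) t.
Proof. by rewrite -[t]treprK -!tpiZ scalerA. Qed.
Lemma tscale1 : left_id 1 tscale.
Proof. by move=> t; rewrite -[t]treprK -tpiZ scale1r. Qed.
Lemma tscaleDr : right_distributive tscale +%R.
Proof.
move=> a s t; rewrite -[s]treprK -[t]treprK -tpiD -!tpiZ -tpiD.
by rewrite scalerDr.
Qed.
Lemma tscaleDl t : {morph tscale^~ t : a b / a + b}.
Proof. by move=> a b; rewrite -[t]treprK -!tpiZ -tpiD scalerDl. Qed.

HB.instance Definition _ :=
  GRing.Zmodule_isLmodule.Build K tensor tscaleA tscale1 tscaleDr tscaleDl.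

Lemma tpi_is_linear : linear tpi.
Proof. by move=> a x y; rewrite tpiD tpiZ. Qed.
HB.instance Definition _ :=
  GRing.isLinear.Build K {malg K[(U * V)%type]} tensor *:%R tpi tpi_is_linear.

Definition tens (u : U) (v : V) : tensor := tpi << (u, v) >>.

Lemma tens_bilinear : bilinear_for *:%R *:%R tens.
Proof.
split=> [v a u u'|u a v v'] /=; rewrite /tens -linearZ -linearD; apply: tpi_eq.
  exact: TensNullL.
exact: TensNullR.
Qed.
HB.instance Definition _ :=
  bilinear_isBilinear.Build K U V tensor *:%R *:%R tens tens_bilinear.

End Tensor.

Notation "U ⊗ V" := (tensor U V) : type_scope.
Notation "u *t v" := (tens u v) : ring_scope.

Section TensorUniversal.
Variables (K : fieldType) (U V W : lmodType K).
Implicit Types f : U -> V -> W.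

Definition tlift f (t : U ⊗ V) : W := lin_ext (fun p => f p.1 p.2) (trepr t).

Lemma lin_ext_null f x : bilinear_for *:%R *:%R f -> tens_null x ->
  lin_ext (fun p => f p.1 p.2) x = 0.
Proof.
move=> [fl fr]; elim=> [|a y z _ y0 _ z0|a u u' v|a u v v'].
- by rewrite linear0.
- by rewrite linearP /= y0 z0 scaler0 addr0.
- by rewrite linearB linearP /= !lin_extU /= (fl v) subrr.
by rewrite linearB linearP /= !lin_extU /= (fr u) subrr.
Qed.

Lemma tlift_pi f x : bilinear_for *:%R *:%R f ->
  tlift f (tpi x) = lin_ext (fun p => f p.1 p.2) x.
Proof.
move=> hf; apply/eqP; rewrite -subr_eq0 /tlift -linearB /=; apply/eqP.
by apply: lin_ext_null => //; apply: tpi_null; rewrite treprK.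
Qed.

Lemma tliftE f u v : bilinear_for *:%R *:%R f -> tlift f (u *t v) = f u v.
Proof. by move=> hf; rewrite tlift_pi // lin_extU. Qed.

Lemma tlift_is_linear f : bilinear_for *:%R *:%R f -> linear (tlift f).
Proof.
move=> hf a s t; rewrite -[s]treprK -[t]treprK -linearP /= !tlift_pi //.
by rewrite linearP.
Qed.

Lemma tlift_fun a f g t :
  tlift (fun u v => a *: f u v + g u v) t = a *: tlift f t + tlift g t.
Proof. exact: lin_ext_fun. Qed.

Lemma eq_tlift f g : f =2 g -> tlift f =1 tlift g.
Proof. by move=> e t; apply: eq_lin_ext => p; apply: e. Qed.

Lemma tens_ext (g h : {linear U ⊗ V -> W}) :
  (forall u v, g (u *t v) = h (u *t v)) -> g =1 h.
Proof.
move=> e t; rewrite -[t]treprK.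
rewrite -!/((_ \o (@tpi K U V)) _) !(lin_ext_uniq (_ \o _)).
by apply: eq_lin_ext => -[u v] /=; rewrite e.
Qed.

End TensorUniversal.

Section TensorMap.
Variables (K : fieldType) (U U' V V' : lmodType K).
Variables (f : {linear U -> U'}) (g : {linear V -> V'}).

Definition tmap : U ⊗ V -> U' ⊗ V' := tlift (fun u v => f u *t g v).

Lemma tmap_bilinear : bilinear_for *:%R *:%R (fun u v => f u *t g v).
Proof. by split=> [v a u u'|u a v v'] /=; rewrite linearP ?linearPl ?linearPr. Qed.

HB.instance Definition _ :=
  GRing.isLinear.Build K (U ⊗ V) (U' ⊗ V') *:%R tmap
    (tlift_is_linear tmap_bilinear).

Lemma tmapE u v : tmap (u *t v) = f u *t g v.
Proof. exact: (tliftE _ _ tmap_bilinear). Qed.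

End TensorMap.

Section TensorAssoc.
Variables (K : fieldType) (U V W : lmodType K).

Definition tassoc : (U ⊗ V) ⊗ W -> U ⊗ (V ⊗ W) :=
  tlift (fun s w => tlift (fun u v => u *t (v *t w)) s).

Lemma tassoc_bilinear2 (w : W) :
  bilinear_for *:%R *:%R (fun (u : U) (v : V) => u *t (v *t w)).
Proof. by split=> [v a u u'|u a v v'] /=; rewrite ?linearPl //= linearPr. Qed.

Lemma tassoc_bilinear : bilinear_for *:%R *:%R
  (fun (s : U ⊗ V) (w : W) => tlift (fun u v => u *t (v *t w)) s).
Proof.
split=> [w|s a w w'] /=; first exact/tlift_is_linear/tassoc_bilinear2.
by rewrite -tlift_fun; apply: eq_tlift => u v; rewrite !linearPr.
Qed.

HB.instance Definition _ :=
  GRing.isLinear.Build K ((U ⊗ V) ⊗ W) (U ⊗ (V ⊗ W)) *:%R tassoc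
    (tlift_is_linear tassoc_bilinear).

Lemma tassocE u v w : tassoc ((u *t v) *t w) = u *t (v *t w).
Proof.
by rewrite /tassoc (tliftE _ _ tassoc_bilinear) (tliftE _ _ (tassoc_bilinear2 w)).
Qed.

End TensorAssoc.

Section TensorUnit.
Variables (K : fieldType) (V : lmodType K).

Definition tlunit : K^o ⊗ V -> V := tlift (fun (a : K^o) v => a *: v).
Definition trunit : V ⊗ K^o -> V := tlift (fun v (a : K^o) => a *: v).

Lemma tlunit_bilinear :
  bilinear_for *:%R *:%R (fun (a : K^o) (v : V) => a *: v).
Proof.
split=> [v a b c|b a v v'] /=; first by rewrite scalerDl scalerA.
by rewrite scalerDr !scalerA mulrC.
Qed.

Lemma trunit_bilinear :
  bilinear_for *:%R *:%R (fun (v : V) (a : K^o) => a *: v).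
Proof. by split=> ?; [apply: tlunit_bilinear.2|apply: tlunit_bilinear.1]. Qed.

HB.instance Definition _ :=
  GRing.isLinear.Build K (K^o ⊗ V) V *:%R tlunit
    (tlift_is_linear tlunit_bilinear).
HB.instance Definition _ :=
  GRing.isLinear.Build K (V ⊗ K^o) V *:%R trunit
    (tlift_is_linear trunit_bilinear).

Lemma tlunitE a v : tlunit ((a : K^o) *t v) = a *: v.
Proof. exact: (tliftE _ _ tlunit_bilinear). Qed.
Lemma trunitE a v : trunit (v *t (a : K^o)) = a *: v.
Proof. exact: (tliftE _ _ trunit_bilinear). Qed.

End TensorUnit.

Section TensorSwap.
Variables (K : fieldType) (A B C D : lmodType K).

Definition tmid : (A ⊗ B) ⊗ (C ⊗ D) -> (A ⊗ C) ⊗ (B ⊗ D) :=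
  tlift (fun s t => tlift (fun a b => tlift (fun c d =>
    (a *t c) *t (b *t d)) t) s).

Lemma tmid_bilinear3 (a : A) (b : B) : bilinear_for *:%R *:%R
  (fun (c : C) (d : D) => (a *t c) *t (b *t d)).
Proof.
by split=> [d k c c'|c k d d'] /=; [rewrite linearPr linearPl|rewrite !linearPr].
Qed.

Lemma tmid_bilinear2 (t : C ⊗ D) : bilinear_for *:%R *:%R
  (fun (a : A) (b : B) => tlift (fun c d => (a *t c) *t (b *t d)) t).
Proof.
split=> [b k a a'|a k b b'] /=; rewrite -tlift_fun; apply: eq_tlift => c d.
  by rewrite !linearPl.
by rewrite linearPl linearPr.
Qed.

Lemma tmid_bilinear : bilinear_for *:%R *:%R
  (fun (s : A ⊗ B) (t : C ⊗ D) => tlift (fun a b => tlift (fun c d =>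
    (a *t c) *t (b *t d)) t) s).
Proof.
split=> [t|s k t t'] /=; first exact/tlift_is_linear/tmid_bilinear2.
rewrite -tlift_fun; apply: eq_tlift => a b.
exact: (tlift_is_linear (tmid_bilinear3 a b)).
Qed.

HB.instance Definition _ :=
  GRing.isLinear.Build K ((A ⊗ B) ⊗ (C ⊗ D)) ((A ⊗ C) ⊗ (B ⊗ D)) *:%R tmid
    (tlift_is_linear tmid_bilinear).

Lemma tmidE a b c d :
  tmid ((a *t b) *t (c *t d)) = (a *t c) *t (b *t d).
Proof.
rewrite /tmid (tliftE _ _ tmid_bilinear) (tliftE _ _ (tmid_bilinear2 _)).
by rewrite (tliftE _ _ (tmid_bilinear3 _ _)).
Qed.

End TensorSwap.

Section Bialgebra.
Variables (K : fieldType) (H : lmodType K).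
Variables (mu : {linear H ⊗ H -> H}) (delta : {linear H -> H ⊗ H}).
Variables (eta : {linear K^o -> H}) (eps : {linear H -> K^o}).

Record is_algebra : Prop := IsAlgebra {
  alg_assoc : forall t : (H ⊗ H) ⊗ H,
    mu (tmap mu idfun t) = mu (tmap idfun mu (tassoc t));
  alg_unitl : forall t : K^o ⊗ H, mu (tmap eta idfun t) = tlunit t;
  alg_unitr : forall t : H ⊗ K^o, mu (tmap idfun eta t) = trunit t
}.

Record is_coalgebra : Prop := IsCoalgebra {
  coalg_assoc : forall x : H,
    tassoc (tmap delta idfun (delta x)) = tmap idfun delta (delta x);
  coalg_unitl : forall x : H, tlunit (tmap eps idfun (delta x)) = x;
  coalg_unitr : forall x : H, trunit (tmap idfun eps (delta x)) = x
}.

(* The last four fields say that delta and eps are morphisms of unital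
   algebras, H ⊗ H carrying the product (a ⊗ b)(c ⊗ d) = ac ⊗ bd. *)
Record is_bialgebra : Prop := IsBialgebra {
  bialg_alg : is_algebra;
  bialg_coalg : is_coalgebra;
  bialg_delta_mu : forall t : H ⊗ H,
    delta (mu t) = tmap mu mu (tmid (tmap delta delta t));
  bialg_delta_eta : delta (eta 1) = eta 1 *t eta 1;
  bialg_eps_mu : forall x y : H, eps (mu (x *t y)) = eps x * eps y;
  bialg_eps_eta : eps (eta 1) = 1
}.

End Bialgebra.

(* Only the hypergraphs that index the basis of H°: finitely many edges and
   vertices, no edge with empty vertex set.  Distinct edges may have the same
   vertex set. *)

Record hypergraph := Hypergraph {
  edge : finType;
  vertex : finType;
  inc : edge -> {set vertex};
  inc_neq0 : forall e, inc e != set0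
}.

Definition hg_iso (G H : hypergraph) : Prop :=
  exists (f : edge G -> edge H) (g : vertex G -> vertex H),
    [/\ bijective f, bijective g & forall e, inc (f e) = g @: inc e].

Section EmptyHypergraph.
Definition hg_empty_inc (e : void) : {set void} := match e with end.
Fact hg_empty_neq0 e : hg_empty_inc e != set0. Proof. by case: e. Qed.
Definition hg_empty : hypergraph := Hypergraph hg_empty_neq0.
End EmptyHypergraph.

Section DisjointUnion.
Variables G H : hypergraph.
Definition hg_union_inc (e : edge G + edge H) : {set vertex G + vertex H} :=
  match e with inl a => inl @: inc a | inr b => inr @: inc b end.
Fact hg_union_neq0 e : hg_union_inc e != set0.
Proof. by case: e => e /=; rewrite imset_eq0 inc_neq0. Qed.
Definition hg_union : hypergraph := Hypergraph hg_union_neq0.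
End DisjointUnion.

Section RestrictContract.
Variables (G : hypergraph) (F : {set edge G}).

Definition hg_restr : hypergraph :=
  @Hypergraph {e | e \in F} (vertex G) (fun e => inc (val e))
    (fun e => inc_neq0 (val e)).

Definition hg_adj : rel (vertex G) :=
  fun u v => [exists e in F, (u \in inc e) && (v \in inc e)].

(* As hg_adj is symmetric, its reflexive transitive closure connect hg_adj is
   the equivalence relation it generates. *)
Definition hg_classes : {set {set vertex G}} :=
  equivalence_partition (connect hg_adj) [set: vertex G].

Definition hg_class_set (v : vertex G) : {set vertex G} :=
  [set u | connect hg_adj v u].

Fact hg_class_subproof v : hg_class_set v \in hg_classes.
Proof. by apply/imsetP; exists v => //; apply/setP => u; rewrite !inE. Qed.

Definition hg_class (v : vertex G) : {B | B \in hg_classes} :=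
  exist _ (hg_class_set v) (hg_class_subproof v).

Definition hg_contr_inc (e : {e | e \in ~: F}) : {set {B | B \in hg_classes}} :=
  hg_class @: inc (val e).
Fact hg_contr_neq0 e : hg_contr_inc e != set0.
Proof. by rewrite imset_eq0 inc_neq0. Qed.
Definition hg_contr : hypergraph := Hypergraph hg_contr_neq0.

Lemma hg_adj_sym : symmetric hg_adj.
Proof. by move=> u v; apply: eq_existsb => e; rewrite [X in _ && X]andbC. Qed.

Lemma hg_connect_sym : connect_sym hg_adj.
Proof. exact/sym_connect_sym/hg_adj_sym. Qed.

Lemma hg_classE u v : (hg_class u == hg_class v) = connect hg_adj u v.
Proof.
rewrite -val_eqE /=; apply/eqP/idP => [|c].
  by move/setP/(_ v); rewrite !inE connect0.
by apply/setP => w; rewrite !inE (same_connect hg_connect_sym c).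
Qed.

Lemma hg_class_surj (B : {B | B \in hg_classes}) : exists v, B = hg_class v.
Proof.
case: B => B hB; case/imsetP: (hB) => v _ eB; exists v.
by apply: val_inj; rewrite /= eB; apply/setP => u; rewrite !inE.
Qed.

End RestrictContract.

Lemma hg_iso_refl G : hg_iso G G.
Proof. by exists id, id; split=> [||e]; rewrite ?imset_id //; exists id. Qed.

Lemma hg_iso_sym G H : hg_iso G H -> hg_iso H G.
Proof.
case=> f [g [[f' fK f'K] [g' gK g'K] hfg]]; exists f', g'.
split=> [||e]; [by exists f | by exists g |].
apply: (imset_inj (can_inj gK)); rewrite -hfg f'K -imset_comp.
by rewrite (eq_imset _ (g := id)) ?imset_id // => v /=; rewrite g'K.
Qed.

Lemma hg_iso_trans G H L : hg_iso G H -> hg_iso H L -> hg_iso G L.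
Proof.
case=> f [g [bf bg hfg]] [f' [g' [bf' bg' hfg']]]; exists (f' \o f), (g' \o g).
split; [exact: bij_comp | exact: bij_comp |] => e.
by rewrite [_ @: inc e]imset_comp -hfg -hfg'.
Qed.

Lemma hg_iso_union G G' H H' :
  hg_iso G G' -> hg_iso H H' -> hg_iso (hg_union G H) (hg_union G' H').
Proof.
case=> f [g [[fi fK fiK] [gi gK giK] hfg]].
case=> f' [g' [[fi' fK' fiK'] [gi' gK' giK'] hfg']].
pose s (A A' B B' : Type) (a : A -> A') (b : B -> B') (x : A + B) : A' + B' :=
  match x with inl y => inl (a y) | inr y => inr (b y) end.
exists (s _ _ _ _ f f'), (s _ _ _ _ g g'); split.
- by exists (s _ _ _ _ fi fi') => -[x|x] /=; congr (_ _).
- by exists (s _ _ _ _ gi gi') => -[x|x] /=; congr (_ _).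
case=> e /=; first by rewrite hfg -!imset_comp; apply: eq_imset.
by rewrite hfg' -!imset_comp; apply: eq_imset.
Qed.

Lemma sub_map_bij (A B : finType) (f : A -> B) (P : {set A}) (Q : {set B}) :
  bijective f -> Q = f @: P ->
  exists2 s : {a | a \in P} -> {b | b \in Q},
    bijective s & forall a, val (s a) = f (val a).
Proof.
move=> bf eQ; have injf := bij_inj bf.
have h (a : {a | a \in P}) : f (val a) \in Q.
  by rewrite eQ mem_imset // (valP a).
exists (fun a => exist _ (f (val a)) (h a)) => //.
apply: inj_card_bij => [x y [/injf /val_inj //]|].
by rewrite !card_sig [#|[pred x in Q]|]/= eQ card_imset.
Qed.

Lemma imset_bij (A B : finType) (f : A -> B) :
  bijective f -> bijective (fun P : {set A} => f @: P).
Proof.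
move=> [f' fK f'K]; exists (fun P : {set B} => f' @: P) => P;
  rewrite -imset_comp -[RHS]imset_id; exact: eq_imset.
Qed.

Section IsoRestrictContract.
Variables (G H : hypergraph) (f : edge G -> edge H) (g : vertex G -> vertex H).
Hypotheses (bf : bijective f) (bg : bijective g).
Hypothesis hfg : forall e, inc (f e) = g @: inc e.
Variable F : {set edge G}.

Lemma hg_iso_restr : hg_iso (hg_restr F) (hg_restr (f @: F)).
Proof.
have [s bs sE] := sub_map_bij bf (erefl (f @: F)).
by exists s, g; split=> // e; rewrite /= -hfg sE.
Qed.

Lemma iso_adj u v : hg_adj (f @: F) (g u) (g v) = hg_adj F u v.
Proof.
have injg := bij_inj bg.
apply/existsP/existsP => -[e /and3P[eF hu hv]].
  case/imsetP: eF hu hv => e' e'F ->; rewrite hfg !mem_imset // => hu hv.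
  by exists e'; rewrite e'F hu.
by exists (f e); rewrite imset_f // hfg !mem_imset // hu.
Qed.

Lemma iso_connect u v :
  connect (hg_adj (f @: F)) (g u) (g v) = connect (hg_adj F) u v.
Proof.
have [g' gK g'K] := bg.
apply/connectP/connectP => -[p hp e].
  exists (map g' p); last by rewrite -[u]gK last_map -e gK.
  rewrite -[u]gK path_map; apply: sub_path hp => x y /=.
  by rewrite -iso_adj !g'K.
exists (map g p); last by rewrite last_map -e.
by rewrite path_map; apply: sub_path hp => x y /=; rewrite iso_adj.
Qed.

Lemma iso_class_set v : g @: hg_class_set F v = hg_class_set (f @: F) (g v).
Proof.
have [g' gK g'K] := bg.
apply/setP => w; rewrite -[w]g'K mem_imset; last exact: bij_inj.
by rewrite !inE iso_connect.
Qed.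

Lemma hg_iso_contr : hg_iso (hg_contr F) (hg_contr (f @: F)).
Proof.
have [g' gK g'K] := bg.
have eC : ~: (f @: F) = f @: ~: F.
  have [f' fK f'K] := bf.
  by apply/setP => e; rewrite -[e]f'K inE !mem_imset ?inE //; apply: bij_inj.
have [s bs sE] := sub_map_bij bf eC.
have eQ : hg_classes (f @: F) = [set g @: (B : {set _}) | B in hg_classes F].
  apply/setP => B; apply/idP/imsetP => [hB|[B' hB' ->]].
    have [v [eB]] := hg_class_surj (exist _ B hB).
    exists (hg_class_set F (g' v)); first exact: hg_class_subproof.
    by rewrite iso_class_set g'K.
  have [v [->]] := hg_class_surj (exist _ B' hB').
  by rewrite iso_class_set hg_class_subproof.
have [q bq qE] := sub_map_bij (imset_bij bg) eQ.
exists s, q; split=> // e /=.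
rewrite /hg_contr_inc sE hfg -!imset_comp; apply: eq_imset => v /=.
by apply: val_inj; rewrite qE /= iso_class_set.
Qed.

End IsoRestrictContract.

(* Every finite hypergraph is isomorphic to one whose edges and vertices are
   initial segments of nat; the latter form a choiceType, whose quotient by
   isomorphism is therefore the set of isomorphism classes of all finite
   hypergraphs (hg_cl_eq, hg_reprK). *)

Definition hg_code : Type :=
  {x : {mn : nat * nat & {ffun 'I_mn.1 -> {set 'I_mn.2}}} |
     [forall e, tagged x e != set0]}.
HB.instance Definition _ := Choice.on hg_code.

Definition hg_decode (x : hg_code) : hypergraph :=
  Hypergraph (fun e => forallP (valP x) e).

Section Encode.
Variable G : hypergraph.
Definition hg_table : {ffun 'I_#|edge G| -> {set 'I_#|vertex G|}} :=
  [ffun i => enum_rank @: inc (enum_val i)].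
Fact hg_encode_subproof : [forall i, hg_table i != set0].
Proof. by apply/forallP => i; rewrite ffunE imset_eq0 inc_neq0. Qed.
Definition hg_encode : hg_code :=
  exist _ (existT (fun mn : nat * nat => {ffun 'I_mn.1 -> {set 'I_mn.2}})
             (#|edge G|, #|vertex G|) hg_table) hg_encode_subproof.
End Encode.

Lemma hg_encode_iso G : hg_iso G (hg_decode (hg_encode G)).
Proof.
exists enum_rank, enum_rank; split; try exact: enum_rank_bij.
by move=> e; rewrite /= ffunE enum_rankK.
Qed.

Definition hg_code_iso : rel hg_code :=
  fun x y => `[< hg_iso (hg_decode x) (hg_decode y) >].

Fact hg_code_iso_refl : reflexive hg_code_iso.
Proof. by move=> x; apply/asboolP/hg_iso_refl. Qed.
Fact hg_code_iso_sym : symmetric hg_code_iso.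
Proof. by move=> x y; apply/asboolP/asboolP; apply: hg_iso_sym. Qed.
Fact hg_code_iso_trans : transitive hg_code_iso.
Proof.
move=> y x z /asboolP xy /asboolP yz; apply/asboolP; exact: hg_iso_trans xy yz.
Qed.
Canonical hg_code_iso_equiv :=
  EquivRel hg_code_iso hg_code_iso_refl hg_code_iso_sym hg_code_iso_trans.

Definition hg_iso_class : Type := {eq_quot hg_code_iso}.
HB.instance Definition _ := Choice.on hg_iso_class.

Definition hg_cl (G : hypergraph) : hg_iso_class :=
  \pi_({eq_quot hg_code_iso}) (hg_encode G).
Definition hg_repr (c : hg_iso_class) : hypergraph :=
  hg_decode (repr (c : {eq_quot hg_code_iso})).

Lemma hg_cl_eq G H : hg_cl G = hg_cl H <-> hg_iso G H.
Proof.
have iG := hg_encode_iso G; have iH := hg_encode_iso H.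
split=> [/eqmodP /asboolP i|i].
  exact: hg_iso_trans iG (hg_iso_trans i (hg_iso_sym iH)).
apply/eqmodP/asboolP.
exact: hg_iso_trans (hg_iso_sym iG) (hg_iso_trans i iH).
Qed.

Lemma hg_reprK : cancel hg_repr hg_cl.
Proof.
move=> c; rewrite -[RHS]reprK; apply/eqmodP/asboolP.
exact/hg_iso_sym/hg_encode_iso.
Qed.

Lemma hg_repr_iso G : hg_iso (hg_repr (hg_cl G)) G.
Proof. by apply/hg_cl_eq; rewrite hg_reprK. Qed.

(* Each structure map is given on the basis by a chosen representative of the
   isomorphism class; hg_mulE, hg_deltaE and hg_counitE show that any
   representative gives the same value. *)

Section HypergraphBialgebra.
Variable K : fieldType.

Definition Hcirc : Type := {malg K[hg_iso_class]}.
HB.instance Definition _ := GRing.Lmodule.on Hcirc.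

Definition hg_basis (G : hypergraph) : Hcirc := << hg_cl G >>.

Definition hg_mul_basis (c d : hg_iso_class) : Hcirc :=
  hg_basis (hg_union (hg_repr c) (hg_repr d)).

Definition hg_mul_bilin (x y : Hcirc) : Hcirc :=
  lin_ext (fun c => lin_ext (fun d => hg_mul_basis c d) y) x.

Lemma hg_mul_bilinear : bilinear_for *:%R *:%R hg_mul_bilin.
Proof.
split=> [y|x a y y']; first exact: lin_ext_is_linear.
rewrite /hg_mul_bilin -lin_ext_fun; apply: eq_lin_ext => c.
by rewrite lin_ext_is_linear.
Qed.

Definition hg_mul : Hcirc ⊗ Hcirc -> Hcirc := tlift hg_mul_bilin.
HB.instance Definition _ :=
  GRing.isLinear.Build K (Hcirc ⊗ Hcirc) Hcirc *:%R hg_mul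
    (tlift_is_linear hg_mul_bilinear).

Definition hg_unit (a : K^o) : Hcirc := a *: hg_basis hg_empty.
Fact hg_unit_is_linear : linear hg_unit.
Proof. by move=> a b c; rewrite /hg_unit scalerDl scalerA. Qed.
HB.instance Definition _ :=
  GRing.isLinear.Build K K^o Hcirc *:%R hg_unit hg_unit_is_linear.

Definition hg_delta_basis (G : hypergraph) : Hcirc ⊗ Hcirc :=
  \sum_(F : {set edge G}) hg_basis (hg_restr F) *t hg_basis (hg_contr F).

Definition hg_delta : Hcirc -> Hcirc ⊗ Hcirc :=
  lin_ext (fun c => hg_delta_basis (hg_repr c)).
HB.instance Definition _ :=
  GRing.isLinear.Build K Hcirc (Hcirc ⊗ Hcirc) *:%R hg_delta
    (lin_ext_is_linear _).

Definition hg_counit : Hcirc -> K^o :=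
  lin_ext (fun c => if #|edge (hg_repr c)| == 0%N then 1 else 0 : K^o).
HB.instance Definition _ :=
  GRing.isLinear.Build K Hcirc K^o *:%R hg_counit (lin_ext_is_linear _).

Lemma hg_mulE G H : hg_mul (hg_basis G *t hg_basis H) = hg_basis (hg_union G H).
Proof.
rewrite /hg_mul (tliftE _ _ hg_mul_bilinear) /hg_mul_bilin !lin_extU.
have /hg_cl_eq e := hg_iso_union (hg_repr_iso G) (hg_repr_iso H).
by rewrite /hg_mul_basis /hg_basis e.
Qed.

Lemma hg_delta_basis_iso G H : hg_iso G H -> hg_delta_basis G = hg_delta_basis H.
Proof.
case=> f [g [bf bg hfg]]; rewrite /hg_delta_basis.
rewrite [RHS](reindex _ (onW_bij _ (imset_bij bf))) /=; apply: eq_bigr => F _.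
have /hg_cl_eq er := hg_iso_restr bf bg hfg F.
have /hg_cl_eq ec := hg_iso_contr bf bg hfg F.
by rewrite /hg_basis er ec.
Qed.

Lemma hg_deltaE G : hg_delta (hg_basis G) =
  \sum_(F : {set edge G}) hg_basis (hg_restr F) *t hg_basis (hg_contr F).
Proof. by rewrite /hg_delta lin_extU; apply/hg_delta_basis_iso/hg_repr_iso. Qed.

Lemma hg_counitE G :
  hg_counit (hg_basis G) = if #|edge G| == 0%N then 1 else 0.
Proof.
rewrite /hg_counit lin_extU; have [f [g [bf _ _]]] := hg_repr_iso G.
by rewrite (bij_eq_card bf).
Qed.

End HypergraphBialgebra.

(* Main.v *)
(* A minor of G is obtained by contracting a set A of edges and keeping, among
   the edges, a set B: its vertices are those of V/A.  This data determines it
   up to isomorphism, minors of minors are minors, and disjoint unions of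
   minors are minors of disjoint unions.  Coassociativity then holds because
   both iterated coproducts of (E, V) are the sum over S ⊆ F ⊆ E of
   (S, V) ⊗ (F \ S, V/S) ⊗ (F^c, V/F), and the coproduct is multiplicative
   because an edge set of a disjoint union is a pair of edge sets. *)

From HB Require Import structures.
Require Import Defs.
From mathcomp Require Import all_boot all_algebra.
From mathcomp Require Import sesquilinear monalg.

Set Implicit Arguments.
Unset Strict Implicit.
Unset Printing Implicit Defensive.

Import GRing.Theory.
Local Open Scope ring_scope.

(** * Minors: uniqueness up to isomorphism and composition *)

(** Both maps are quotients of [I] by the same equivalence relation, so a section of one followed by
    the other does not depend on the section. *)
Lemma surj_factor (I J W : finType) (p : I -> J) (r : I -> W) :
  (forall j, exists i, p i = j) -> (forall w, exists i, r i = w) ->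
  (forall i i', (p i == p i') = (r i == r i')) ->
  exists2 s : J -> W, bijective s & forall i, s (p i) = r i.
Proof.
move=> pS rS pr.
have [p' p'K] := fin_all_exists pS; have [r' r'K] := fin_all_exists rS.
have rp i i' : p i = p i' -> r i = r i' by move/eqP; rewrite pr => /eqP.
have pr' i i' : r i = r i' -> p i = p i' by move/eqP; rewrite -pr => /eqP.
exists (r \o p'); last by move=> i; apply: rp.
exists (p \o r') => [j|w] /=; first by rewrite -[RHS]p'K; apply: pr'.
by rewrite -[RHS]r'K; apply: rp.
Qed.

(* L is G with A contracted and only the edges in B kept: f embeds the edges
   of L in those of G, and q is the quotient map on vertices. *)
Record is_minor (G : hypergraph) (A B : {set edge G}) (L : hypergraph)
    (f : edge L -> edge G) (q : vertex G -> vertex L) : Prop := IsMinor {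
  minor_inj : injective f;
  minor_edges : f @: setT = B;
  minor_surj : forall w, exists v, q v = w;
  minor_class : forall u v, (q u == q v) = connect (hg_adj A) u v;
  minor_inc : forall e, inc e = q @: inc (f e)
}.

(** The vertex sets are quotients of [vertex G] by the same relation, which gives [s]. The edges of
    [L] and [L'] are matched through their common image in [edge G]; an injection between sets of
    equal size is bijective. *)
Lemma minor_iso G A A' B B' L L' f f' q q' :
    @is_minor G A B L f q -> @is_minor G A' B' L' f' q' ->
  A = A' -> B = B' -> hg_iso L L'.
Proof.
move=> m m' eA eB; case: m m'; rewrite {A}eA {B}eB.
move=> fI fB qS qC qE [f'I f'B q'S q'C q'E].
have qq' u v : (q u == q v) = (q' u == q' v) by rewrite qC q'C.
have [s bs sE] := surj_factor qS q'S qq'.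
have f_ e : exists e', f' e' = f e.
  have : f e \in f' @: setT by rewrite f'B -fB imset_f ?inE.
  by case/imsetP=> e' _ ->; exists e'.
have [g gE] := fin_all_exists f_.
have cE : #|edge L| = #|edge L'|.
  by rewrite -!cardsT -(card_imset _ fI) -(card_imset _ f'I) fB f'B.
exists g, s; split=> // [|e].
  by apply: inj_card_bij; rewrite ?cE // => x y e; apply: fI; rewrite -!gE e.
by rewrite q'E gE qE -imset_comp; apply: eq_imset => v /=.
Qed.

Lemma homo_connect (T T' : finType) (e : rel T) (e' : rel T') (h : T -> T') :
    {homo h : x y / e x y >-> connect e' x y} ->
  {homo h : x y / connect e x y >-> connect e' x y}.
Proof.
move=> he x y /connectP[p]; elim: p x => [|z p IHp] x /=; first by move=> _ ->.
by case/andP=> /he xz /IHp{}IHp /IHp; apply: connect_trans.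
Qed.

Lemma connect_hg_adj0 G (u v : vertex G) : connect (hg_adj set0) u v = (u == v).
Proof.
apply/idP/eqP => [/connectP[[|w p] /=]|->]; last exact: connect0.
  by move=> _ ->.
by case/andP=> /existsP[e]; rewrite inE.
Qed.

Lemma val_imsetT (T : finType) (P : {set T}) :
  [set val x | x in [set: {x | x \in P}]] = P.
Proof.
apply/setP => x; apply/imsetP/idP => [[y _ ->]|xP]; first exact: (valP y).
by exists (exist _ x xP).
Qed.

Lemma minor_refl G : @is_minor G set0 setT G id id.
Proof.
split=> [//||w|u v|e]; rewrite ?imset_id //; first by exists w.
by rewrite connect_hg_adj0.
Qed.

Lemma minor_restr G (F : {set edge G}) :
  @is_minor G set0 F (hg_restr F) val id.
Proof.
split=> [||w|u v|e]; first exact: val_inj; first exact: val_imsetT.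
- by exists w.
- by rewrite connect_hg_adj0.
by rewrite imset_id.
Qed.

Lemma minor_contr G (F : {set edge G}) :
  @is_minor G F (~: F) (hg_contr F) val (hg_class F).
Proof.
split=> [||w|u v|e] //; first exact: val_inj; first exact: val_imsetT.
- by have [v] := hg_class_surj w; exists v.
- exact: hg_classE.
Qed.

(** A path in [L] lifts to [G] because the fibres of [q] are already connected through [A].
    Conversely, [q] collapses each edge of [A] to a point and sends [f e] onto the edge [e] of
    [L]. *)
Lemma minor_connect G A B L f q (A' : {set edge L}) u v :
    @is_minor G A B L f q ->
  connect (hg_adj A') (q u) (q v) = connect (hg_adj (A :|: f @: A')) u v.
Proof.
case=> fI _ qS qC qE; set C := A :|: _.
have sub x y : q x = q y -> connect (hg_adj C) x y.
  move/eqP; rewrite qC; apply: connect_sub => {}x {}y /exists_inP[e eA xy].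
  by apply/connect1/exists_inP; exists e => //; rewrite inE eA.
apply/idP/idP => [/connectP[p]|].
  elim: p u => [|w p IHp] u /=; first by move=> _ /esym /sub.
  case/andP=> /exists_inP[a aA'] /andP[]; rewrite qE.
  move=> /imsetP[x xa ux] /imsetP[y ya ->] /IHp{}IHp /IHp.
  (* [u] reaches [x] inside a fibre of [q], then [x] and [y] lie on the common edge [f a], and the
     induction hypothesis continues from [y]. *)
  apply: connect_trans; apply: connect_trans (sub _ _ ux) _.
  apply/connect1/exists_inP; exists (f a); last by rewrite xa.
  by rewrite inE imset_f ?orbT.
apply: homo_connect => {u v}u w /exists_inP[a aC /andP[ua wa]].
case/setUP: aC => [aA|/imsetP[e eA' ae]].
  suff /eqP-> : q u == q w by [].
  by rewrite qC; apply/connect1/exists_inP; exists a; rewrite ?ua.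
by apply/connect1/exists_inP; exists e; rewrite // qE -ae !imset_f.
Qed.

Lemma minor_trans G A B L f q A' B' L' f' q' :
  @is_minor G A B L f q -> @is_minor L A' B' L' f' q' ->
  is_minor (A :|: f @: A') (f @: B') (f \o f') (q' \o q).
Proof.
move=> m; have [fI fB qS qC qE] := m; case=> f'I f'B q'S q'C q'E.
split=> [||w|u v|e].
- exact: inj_comp.
- by rewrite imset_comp f'B.
- by have [w' <-] := q'S w; have [v <-] := qS w'; exists v.
- by rewrite /= q'C (minor_connect _ _ _ m).
- by rewrite q'E qE /= -imset_comp.
Qed.

Lemma hg_iso_contr0 G : hg_iso G (hg_contr (set0 : {set edge G})).
Proof.
by apply: minor_iso (minor_refl G) (minor_contr _) _ _; rewrite ?setC0.
Qed.

Lemma hg_iso_restrT G : hg_iso G (hg_restr [set: edge G]).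
Proof. exact: minor_iso (minor_refl G) (minor_restr _) _ _. Qed.

(** * Edge sets and minors of disjoint unions *)

Section SumSet.
Variables I J : finType.
Implicit Types (A : {set I}) (B : {set J}).

Lemma in_inl_imset A x :
  (x \in @inl I J @: A) = if x is inl i then i \in A else false.
Proof.
case: x => [i|j]; first by rewrite mem_imset // => ? ? [].
by apply/imsetP => -[].
Qed.

Lemma in_inr_imset B x :
  (x \in @inr I J @: B) = if x is inr j then j \in B else false.
Proof.
case: x => [i|j]; last by rewrite mem_imset // => ? ? [].
by apply/imsetP => -[].
Qed.

Definition sum_set A B : {set I + J} := inl @: A :|: inr @: B.

Lemma in_sum_set A B x :
  x \in sum_set A B = match x with inl i => i \in A | inr j => j \in B end.
Proof. by rewrite inE in_inl_imset in_inr_imset; case: x => x; rewrite ?orbF. Qed.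

Lemma sum_set_bij :
  bijective (fun p : {set I} * {set J} => sum_set p.1 p.2).
Proof.
exists (fun C : {set I + J} => ([set i | inl i \in C], [set j | inr j \in C])).
  by case=> A B; congr (_, _); apply/setP => x; rewrite inE in_sum_set.
by move=> C; apply/setP => -[] x; rewrite in_sum_set inE.
Qed.

End SumSet.

Section Union.
Variables G H : hypergraph.

Definition sum_map (I I' J J' : Type) (a : I -> I') (b : J -> J') (x : I + J) :=
  match x with inl i => inl (a i) | inr j => inr (b j) end.

Lemma hg_union_adj A A' x y :
  @hg_adj (hg_union G H) (sum_set A A') x y =
  match x, y with
  | inl u, inl v => hg_adj A u v
  | inr u, inr v => hg_adj A' u v
  | _, _ => false
  end.
Proof.
apply/exists_inP/idP => [[e]|].
  rewrite in_sum_set; case: e => e eA; case: x y => x [] y /=;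
    rewrite ?in_inl_imset ?in_inr_imset ?andbF // => xy;
    by apply/exists_inP; exists e.
case: x y => x [] y // /exists_inP[e eA xy].
  by exists (inl e); rewrite ?in_sum_set //= !in_inl_imset.
by exists (inr e); rewrite ?in_sum_set //= !in_inr_imset.
Qed.

(** No edge of a disjoint union meets both summands, so paths stay in one summand and the classes
    are those of the two summands. *)
Lemma minor_union A B L f q A' B' L' f' q' :
  @is_minor G A B L f q -> @is_minor H A' B' L' f' q' ->
  @is_minor (hg_union G H) (sum_set A A') (sum_set B B') (hg_union L L')
    (sum_map f f') (sum_map q q').
Proof.
case=> fI fB qS qC qE [f'I f'B q'S q'C q'E].
have E1 : sum_map f f' @: setT = sum_set B B'.
  apply/setP => -[] e; rewrite in_sum_set -?fB -?f'B; apply/imsetP/imsetP.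
  - by case=> -[] x // _ [->]; exists x.
  - by case=> x _ ->; exists (inl x).
  - by case=> -[] x // _ [->]; exists x.
  - by case=> x _ ->; exists (inr x).
split=> [|//|||].
- by case=> x [] y //= [] => [/fI|/f'I] ->.
- by case=> w; [have [v <-] := qS w; exists (inl v)
              | have [v <-] := q'S w; exists (inr v)].
- move=> x y; apply/eqP/idP => [|/connectP[p]].
    case: x y => x [] y //= [] /eqP.
      rewrite qC; apply: (homo_connect (h := inl)) => {x y}x y xy.
      by apply: connect1; rewrite hg_union_adj.
    rewrite q'C; apply: (homo_connect (h := inr)) => {x y}x y xy.
    by apply: connect1; rewrite hg_union_adj.
  elim: p x => [|z p IHp] x; first by move=> _ ->.
  case/andP=> xz /IHp{}IHp /IHp <-; move: xz; rewrite hg_union_adj.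
  case: x z {IHp} => x [] z //= /connect1; first by rewrite -qC => /eqP->.
  by rewrite -q'C => /eqP->.
by case=> e /=; rewrite ?qE ?q'E -!imset_comp.
Qed.

End Union.

(** * Restrictions and contractions, iterated or of disjoint unions *)

Lemma hg_iso_restr_restr G (F : {set edge G}) (S : {set edge (hg_restr F)}) :
  hg_iso (hg_restr S) (hg_restr [set val e | e in S]).
Proof.
apply: minor_iso (minor_trans (minor_restr F) (minor_restr S))
  (minor_restr _) _ _ => //.
by rewrite imset0 setU0.
Qed.

(** The middle factor of the iterated coproduct. The edges of [hg_contr S] avoid [S], so selecting
    those in [F] leaves exactly [F :\: S]. *)
Definition hg_minor G (S F : {set edge G}) : hypergraph :=
  @hg_restr (hg_contr S) [set e | val e \in F].

(** The two maps can stay existential, since [minor_iso] asks only for equality of the contracted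
    and the kept edge sets. *)
Lemma minor_hg_minor G (S F : {set edge G}) :
  exists f q, @is_minor G S (F :\: S) (hg_minor S F) f q.
Proof.
have := minor_trans (minor_contr S)
  (@minor_restr (hg_contr S) [set e | val e \in F]).
rewrite imset0 setU0; set B := _ @: _.
suff -> : B = F :\: S by do 2!eexists; eauto.
apply/setP => e; rewrite inE; apply/imsetP/andP => [[x xF ->]|[eS eF]].
  by have := valP x; rewrite !inE in xF *.
have eS' : e \in ~: S by rewrite inE.
by exists (exist _ e eS'); rewrite ?inE.
Qed.

Lemma val_imsetC (T : finType) (P : {set T}) (A : {set {x | x \in P}}) :
  [set val x | x in ~: A] = P :\: [set val x | x in A].
Proof.
apply/setP => x; rewrite inE; apply/imsetP/andP => [[y yA ->]|[xA xP]].
  by rewrite (mem_imset _ _ val_inj) (valP y); rewrite inE in yA.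
exists (exist _ x xP) => //; rewrite inE; apply: contra xA => xA.
by apply/imsetP; exists (exist _ x xP).
Qed.

Lemma hg_iso_contr_restr G (F : {set edge G}) (S : {set edge (hg_restr F)}) :
  hg_iso (hg_contr S) (hg_minor [set val e | e in S] F).
Proof.
have [f [q m]] := minor_hg_minor [set val e | e in S] F.
apply: minor_iso (minor_trans (minor_restr F) (minor_contr S)) m _ _.
  by rewrite set0U.
exact: val_imsetC.
Qed.

Lemma hg_iso_contr_contr G (S : {set edge G}) (F : {set edge (hg_contr S)}) :
  hg_iso (hg_contr F) (hg_contr (S :|: [set val e | e in F])).
Proof.
apply: minor_iso (minor_trans (minor_contr S) (minor_contr F))
  (minor_contr _) _ _ => //.
by rewrite val_imsetC setDE setCU.
Qed.

Lemma hg_iso_restr_union G H (A : {set edge G}) (B : {set edge H}) :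
  hg_iso (@hg_restr (hg_union G H) (sum_set A B))
         (hg_union (hg_restr A) (hg_restr B)).
Proof.
apply: minor_iso (@minor_restr (hg_union G H) _)
  (minor_union (minor_restr A) (minor_restr B)) _ _ => //.
by rewrite /sum_set !imset0 setU0.
Qed.

Lemma hg_iso_contr_union G H (A : {set edge G}) (B : {set edge H}) :
  hg_iso (@hg_contr (hg_union G H) (sum_set A B))
         (hg_union (hg_contr A) (hg_contr B)).
Proof.
apply: minor_iso (@minor_contr (hg_union G H) _)
  (minor_union (minor_contr A) (minor_contr B)) _ _ => //.
by apply/setP => -[] e; rewrite inE !in_sum_set inE.
Qed.

(** * Associativity and unit laws of disjoint union *)

Lemma hg_iso_unionA G H L :
  hg_iso (hg_union (hg_union G H) L) (hg_union G (hg_union H L)).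
Proof.
pose s (A B C : Type) (x : (A + B) + C) : A + (B + C) :=
  match x with
  | inl (inl a) => inl a | inl (inr b) => inr (inl b) | inr c => inr (inr c)
  end.
have bs A B C : bijective (@s A B C).
  by exists (fun x => match x with
      | inl a => inl (inl a) | inr (inl b) => inl (inr b) | inr (inr c) => inr c
    end) => [[[]|]|[|[]]].
exists (@s _ _ _), (@s _ _ _); split; [exact: bs | exact: bs |].
by move=> -[[]|] e /=; rewrite -!imset_comp; apply: eq_imset.
Qed.

Lemma hg_iso_union0l G : hg_iso (hg_union hg_empty G) G.
Proof.
pose s (A : Type) (x : void + A) : A :=
  match x with inl v => match v with end | inr a => a end.
have bs A : bijective (@s A) by exists inr => // -[[]|].
exists (@s _), (@s _); split; [exact: bs | exact: bs |] => -[[]|] e /=.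
by rewrite -imset_comp (eq_imset _ (g := id)) ?imset_id.
Qed.

Lemma hg_iso_union0r G : hg_iso (hg_union G hg_empty) G.
Proof.
pose s (A : Type) (x : A + void) : A :=
  match x with inr v => match v with end | inl a => a end.
have bs A : bijective (@s A) by exists inl => // -[|[]].
exists (@s _), (@s _); split; [exact: bs | exact: bs |] => -[|[]] e /=.
by rewrite -imset_comp (eq_imset _ (g := id)) ?imset_id.
Qed.

(** * Evaluating and comparing linear maps on tensor products *)

Lemma tmap_idlE (K : fieldType) (U V V' : lmodType K) (g : {linear V -> V'}) u v :
  tmap (@idfun U) g (u *t v) = u *t g v.
Proof. exact: tmapE. Qed.

Lemma tmap_idrE (K : fieldType) (U U' V : lmodType K) (f : {linear U -> U'}) u v :
  tmap f (@idfun V) (u *t v) = f u *t v.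
Proof. exact: tmapE. Qed.

(** Linearity is a plain hypothesis here, so that composites can be compared without first being
    bundled as linear maps. *)
Lemma linear_tens_ext (K : fieldType) (U V W : lmodType K) (g h : U ⊗ V -> W) :
  linear g -> linear h -> (forall u v, g (u *t v) = h (u *t v)) -> g =1 h.
Proof.
move=> lg lh.
pose g' : {linear U ⊗ V -> W} :=
  HB.pack g (GRing.isLinear.Build K _ W *:%R g lg).
pose h' : {linear U ⊗ V -> W} :=
  HB.pack h (GRing.isLinear.Build K _ W *:%R h lh).
exact: (@tens_ext _ _ _ _ g' h').
Qed.

(* The proof runs over an abstract module H spanned by the b G rather than over
   Hcirc, whose definition unification would otherwise unfold endlessly. *)
Section Bialgebra.
Variables (K : fieldType) (H : lmodType K) (b : hypergraph -> H).
Notation "[ G ]" := (b G).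
Hypothesis b_iso : forall G G', hg_iso G G' -> [G] = [G'].
Hypothesis b_span : forall (W : lmodType K) (g h : H -> W),
  linear g -> linear h -> (forall G, g [G] = h [G]) -> g =1 h.

Lemma tens_span_ext (V W : lmodType K) (g h : V ⊗ H -> W) :
    linear g -> linear h -> (forall v G, g (v *t [G]) = h (v *t [G])) ->
  g =1 h.
Proof.
move=> lg lh e; apply: linear_tens_ext => // v.
by apply: b_span => [a x y|a x y|G] //; rewrite linearPr ?lg ?lh.
Qed.

Lemma span_tens_ext (V W : lmodType K) (g h : H ⊗ V -> W) :
    linear g -> linear h -> (forall G v, g ([G] *t v) = h ([G] *t v)) ->
  g =1 h.
Proof.
move=> lg lh e; apply: linear_tens_ext => // u v; move: u.
by apply: b_span => [a x y|a x y|G] //; rewrite linearPl ?lg ?lh.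
Qed.

Lemma span_tens2_ext (W : lmodType K) (g h : H ⊗ H -> W) :
    linear g -> linear h ->
    (forall G G', g ([G] *t [G']) = h ([G] *t [G'])) ->
  g =1 h.
Proof.
move=> lg lh e; apply: tens_span_ext => // v G'; move: v.
by apply: b_span => [a x y|a x y|G] //; rewrite linearPl ?lg ?lh.
Qed.

Lemma span_tens3_ext (W : lmodType K) (g h : (H ⊗ H) ⊗ H -> W) :
    linear g -> linear h ->
    (forall G G' G'', g ([G] *t [G'] *t [G'']) = h ([G] *t [G'] *t [G''])) ->
  g =1 h.
Proof.
move=> lg lh e; apply: tens_span_ext => // v G''; move: v.
by apply: span_tens2_ext => [a x y|a x y|G G'] //; rewrite linearPl ?lg ?lh.
Qed.

(** * The bialgebra axioms, checked on spanning elements *)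

Variables (mu : {linear H ⊗ H -> H}) (delta : {linear H -> H ⊗ H}).
Variables (eta : {linear K^o -> H}) (eps : {linear H -> K^o}).
Hypothesis muE : forall G G', mu ([G] *t [G']) = [hg_union G G'].
Hypothesis deltaE : forall G,
  delta [G] = \sum_(F : {set edge G}) [hg_restr F] *t [hg_contr F].
Hypothesis etaE : forall a, eta a = a *: [hg_empty].
Hypothesis epsE : forall G, eps [G] = if #|edge G| == 0%N then 1 else 0.

Lemma hg_is_algebra : is_algebra mu eta.
Proof.
split.
- apply: span_tens3_ext => [a x y|a x y|G G' G''];
  [by rewrite 2!linearP | by rewrite 3!linearP |].
  by rewrite tassocE !tmap_idlE !tmap_idrE !muE; apply/b_iso/hg_iso_unionA.
- apply: tens_span_ext => [a x y|a x y|a G];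
  [by rewrite !linearP | by rewrite !linearP |].
  rewrite tlunitE tmap_idrE etaE linearZl_LR linearZ muE.
  by rewrite (b_iso (hg_iso_union0l G)).
- apply: span_tens_ext => [a x y|a x y|G a];
  [by rewrite !linearP | by rewrite !linearP |].
  rewrite trunitE tmap_idlE etaE linearZr_LR linearZ muE.
  by rewrite (b_iso (hg_iso_union0r G)).
Qed.

Lemma hg_coassoc (x : H) :
  tassoc (tmap delta idfun (delta x)) = tmap idfun delta (delta x).
Proof.
move: x; apply: b_span => [a x y|a x y|G];
  [by rewrite !linearP | by rewrite !linearP |].
rewrite deltaE !linear_sum /=.
pose T S F := [hg_restr S] *t ([@hg_minor G S F] *t [hg_contr F]).
transitivity
  (\sum_(F : {set edge G}) \sum_(S : {set edge G} | S \subset F) T S F).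
  apply: eq_bigr => F _; rewrite tmap_idrE deltaE linear_sumlz linear_sum.
  (* Taking images in [edge G] identifies the edge sets of [hg_restr F] with the subsets of [F]. *)
  rewrite [RHS](reindex_onto
    (fun S : {set edge (hg_restr F)} => [set val e | e in S])
    (fun S => [set e | val e \in S])) /=; last first.
    move=> S /subsetP SF; apply/setP => e; apply/imsetP/idP => [[y]|eS].
      by rewrite inE => yS ->.
    by exists (exist _ e (SF e eS)); rewrite ?inE.
  apply: eq_big => [S|S _].
    apply/esym/andP; split.
      by apply/subsetP => e /imsetP[y _ ->]; apply: (valP y).
    by apply/eqP/setP => e; rewrite inE (mem_imset _ _ val_inj).
  rewrite tassocE /T (b_iso (hg_iso_restr_restr S)).
  by rewrite (b_iso (hg_iso_contr_restr S)).
(* With [S] outermost, both sides are sums over the edge set of the first tensor factor and can be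
   compared for each [S]. *)
rewrite (exchange_big_dep predT) //=; apply: eq_bigr => S _.
rewrite tmap_idlE deltaE linear_sumr.
(* The edges of [hg_contr S] are those of [G] outside [S]; adding [S] back turns their subsets into
   exactly the sets [F] containing [S]. *)
rewrite (reindex_onto
  (fun F : {set edge (hg_contr S)} => S :|: [set val e | e in F])
  (fun F => [set e | val e \in F])) /=; last first.
  move=> F /subsetP SF; apply/setP => e; rewrite inE.
  have [eS|eS] /= := boolP (e \in S); first by rewrite SF.
  apply/imsetP/idP => [[y]|eF]; first by rewrite inE => yS ->.
  have eS' : e \in ~: S by rewrite inE.
  by exists (exist _ e eS'); rewrite ?inE.
(* This both inverts the reindexing and identifies the middle factor of [T] with [hg_restr F]. *)
have SFE (F : {set edge (hg_contr S)}) :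
    [set e | val e \in S :|: [set val e | e in F]] = F.
  apply/setP => e; rewrite !inE (mem_imset _ _ val_inj).
  by have := valP e; rewrite inE => /negPf->.
apply: eq_big => [F|F _].
  by rewrite subsetUl SFE eqxx.
by rewrite /T /hg_minor SFE (b_iso (hg_iso_contr_contr F)).
Qed.

Lemma hg_is_coalgebra : is_coalgebra delta eps.
Proof.
split; first exact: hg_coassoc.
- apply: b_span => [a x y|a x y|G]; [by rewrite !linearP | by [] |].
  (* [eps] kills [hg_restr F] unless [F] is empty, and contracting nothing returns [G]. *)
  rewrite deltaE !linear_sum (bigD1 set0) //= big1 ?addr0 => [|F F0].
    rewrite tmap_idrE tlunitE epsE card_sig eq_card0 ?eqxx ?scale1r => [|e].
      by rewrite -(b_iso (hg_iso_contr0 G)).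
    by rewrite !inE.
  rewrite tmap_idrE tlunitE epsE card_sig.
  rewrite [#|_|](_ : _ = #|F|) ?cards_eq0; last exact: eq_card.
  by rewrite (negPf F0) scale0r.
apply: b_span => [a x y|a x y|G]; [by rewrite !linearP | by [] |].
(* Dually, [hg_contr F] has no edge only for [F = setT], and restricting to all edges returns
   [G]. *)
rewrite deltaE !linear_sum (bigD1 setT) //= big1 ?addr0 => [|F F0].
  rewrite tmap_idlE trunitE epsE card_sig eq_card0 ?eqxx ?scale1r => [|e].
    by rewrite -(b_iso (hg_iso_restrT G)).
  by rewrite !inE.
rewrite tmap_idlE trunitE epsE card_sig.
rewrite [#|_|](_ : _ = #|~: F|) ?cards_eq0; last exact: eq_card.
by rewrite -setCT (inj_eq (@setC_inj _)) (negPf F0) scale0r.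
Qed.

Lemma hg_is_bialgebra : is_bialgebra mu delta eta eps.
Proof.
split; first exact: hg_is_algebra; first exact: hg_is_coalgebra.
- apply: span_tens2_ext => [a s t|a s t|G G'];
  [by rewrite !linearP | by rewrite !linearP |].
  rewrite muE tmapE !deltaE linear_sumlz !linear_sum /=.
  (* The sum over edge sets of the disjoint union becomes a sum over pairs, matching the product of
     the two coproducts. *)
  rewrite (reindex _ (onW_bij _ (sum_set_bij _ _))) /=.
  under [RHS]eq_bigr do rewrite linear_sumr !linear_sum /=.
  rewrite pair_big /=; apply: eq_bigr => -[A B] _ /=.
  rewrite tmidE tmapE !muE (b_iso (hg_iso_restr_union A B)).
  by rewrite (b_iso (hg_iso_contr_union A B)).
- rewrite /= etaE scale1r deltaE (big_pred1 set0) => [|F]; last first.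
    by apply/esym/eqP/setP => -[].
  congr (_ *t _); apply/esym/b_iso; last exact: hg_iso_contr0.
  (* Without edges, the empty edge set is also the full one. *)
  rewrite (_ : set0 = setT); first exact: hg_iso_restrT.
  by apply/setP => -[].
- move=> x y; move: x.
  (* Both sides are linear in each argument separately, so the arguments are reduced to spanning
     elements one at a time. *)
  apply: b_span => [a x x'|a x x'|G].
  + by rewrite linearPl !linearP.
  + by rewrite linearP /= mulrDl -scalerAl.
  move: y; apply: b_span => [a x x'|a x x'|G'].
  + by rewrite linearPr !linearP.
  + by rewrite linearP /= mulrDr -scalerAr.
  rewrite muE !epsE card_sum addn_eq0.
  by do 2![case: (_ == 0)%N]; rewrite /= ?mulr1 ?mulr0.
by rewrite /= etaE scale1r epsE card_void.
Qed.

End Bialgebra.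

(** * Specialisation to [Hcirc] *)

Lemma hg_basis_iso K G G' : hg_iso G G' -> hg_basis K G = hg_basis K G'.
Proof. by rewrite /hg_basis => /hg_cl_eq ->. Qed.

Lemma hg_basis_ext (K : fieldType) (W : lmodType K) (g h : Hcirc K -> W) :
    linear g -> linear h ->
    (forall G, g (hg_basis K G) = h (hg_basis K G)) ->
  g =1 h.
Proof.
move=> lg lh e x.
pose g' : {linear Hcirc K -> W} :=
  HB.pack g (GRing.isLinear.Build K _ W *:%R g lg).
pose h' : {linear Hcirc K -> W} :=
  HB.pack h (GRing.isLinear.Build K _ W *:%R h lh).
have -> : g x = lin_ext (fun c => g << c >>) x by exact: (lin_ext_uniq g').
have -> : h x = lin_ext (fun c => h << c >>) x by exact: (lin_ext_uniq h').
(* Each isomorphism class is the class of its chosen representative, so every basis vector has the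
   form [hg_basis K G]. *)
by apply: eq_lin_ext => c; rewrite -[c]hg_reprK; apply: e.
Qed.

Theorem proposition4p3 (K : fieldType) :
  is_bialgebra (@hg_mul K) (@hg_delta K) (@hg_unit K) (@hg_counit K).
Proof.
apply: (@hg_is_bialgebra K (Hcirc K) (hg_basis K) (@hg_basis_iso K)
  (@hg_basis_ext K) (@hg_mul K) (@hg_delta K) (@hg_unit K) (@hg_counit K)).
- exact: hg_mulE.
- exact: hg_deltaE.
- by [].
- exact: hg_counitE.
Qed.
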